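(* Suppose $|a|_p<\alpha=\beta$. For $x\in S_{\alpha^2/|a|_p}(0)$ put $a^*(x)=|f(x)|_p$. Then the $p$-adic dynamical system generated by $f$ has the following properties. 1. (1.1) $SI(x_1)=U_{\alpha}(0)$. (1.2) $\mathcal P\subset S_{\alpha}(0)$. 2. If $r>\alpha$ and $x\in S_r(0)$, then for every $n\ge 1$: $f^n(x)\in S_{\alpha^2/r}(0)$ if $\alpha<r<\alpha^2/|a|_p$; $f^n(x)\in S_{a^*(x)}(0)$ if $r=\alpha^2/|a|_p$; $f^n(x)\in S_{|a|_p}(0)$ if $r>\alpha^2/|a|_p$. 3. If $x\in S_\alpha(0)\setminus\mathcal P$, then one of the following two possibilities holds: (3.1) there exist $k\in\mathbb N$ and $\mu_k>\alpha$ such that $f^k(x)\in S_{\mu_k}(0)$, and for every $m\ge k+1$: $f^m(x)\in S_{\alpha^2/\mu_k}(0)$ if $\alpha<\mu_k<\alpha^2/|a|_p$; $f^m(x)\in S_{a^*(f^k(x))}(0)$ if $\mu_k=\alpha^2/|a|_p$; $f^m(x)\in S_{|a|_p}(0)$ if $\mu_k>\alpha^2/|a|_p$; and $f^m(x)\in S_\alpha(0)$ for $m\le k-1$; (3.2) the trajectory $\{f^k(x):k\ge 1\}$ is a subset of $S_\alpha(0)$. 4. If $|d|_p<\alpha$, then $|f'(x_2)|_p=1$ and $SI(x_2)=SI(x_1)$. 5. Let $|d|_p=\alpha$. Then $x_2\in S_\alpha(0)$ and (5.1) if $|b+(a-d)d|_p<\alpha^2$, then $x_2$ is an attractive fixed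 point of $f$ and its basin of attraction is $A(x_2)=U_\alpha(x_2)\subset S_\alpha(0)$; (5.2) if $|b+(a-d)d|_p=\alpha^2$, then $x_2$ is an indifferent fixed point of $f$ and $SI(x_2)=U_\alpha(x_2)\subset S_\alpha(0)$.
   Context: $p$ is a prime and $\mathbb C_p$ is the field of complex $p$-adic numbers with norm $|\cdot|_p$. Let $a,b,d\in\mathbb C_p$ with $ab\neq0$, $a\ne d$, and $$f(x)=\frac{ax^2+bx}{x^2+dx+b},\qquad x\in\mathbb C_p\setminus\{\hat x_1,\hat x_2\},$$ where $\hat x_1,\hat x_2\in\mathbb C_p$ are the two (possibly equal) roots of $x^2+dx+b$. Put $\alpha=|\hat x_1|_p$, $\beta=|\hat x_2|_p$, labelled so that $\alpha\le\beta$. Standing assumption: $f$ has the two distinct fixed points $x_1=0$ and $x_2=a-d$ (in particular $x_2\notin\{\hat x_1,\hat x_2\}$, i.e. $b+a(a-d)\neq0$). $\mathcal P=\{x\in\mathbb C_p:\exists n\in\mathbb N\cup\{0\},\ f^n(x)\in\{\hat x_1,\hat x_2\}\}$, where $f^n$ is the $n$-th iterate ($f^0=\mathrm{id}$). For $c\in\mathbb C_p$, $r\geq 0$: $U_r(c)=\{x:|x-c|_p<r\}$, $V_r(c)=\{x:|x-c|_p\le r\}$, $S_r(c)=\{x:|x-c|_p=r\}$ (so $S_0(0)=\{0\}$). A fixed point $x_0$ is attractive, indifferent, repeller if $|f'(x_0)|_p<1$, $=1$, $>1$ respectively. The basin of attraction is $A(x_0)=\{x: f^n(x)\text{ is defined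 for all }n\text{ and }f^n(x)\to x_0\}$. A sphere $S$ is invariant if $f$ is defined on $S$ and $f(S)\subset S$. An open ball $U_r(x_0)$ about a fixed point $x_0$ is a Siegel disk if every sphere $S_\rho(x_0)$, $0<\rho<r$, is invariant; $SI(x_0)$ is the union of all Siegel disks centred at $x_0$ (the maximal Siegel disk). *)

(* Defs.v *)
From mathcomp Require Import all_boot all_order all_algebra.
From mathcomp Require Import all_classical all_reals all_analysis.
Set Implicit Arguments.
Unset Strict Implicit.
Unset Printing Implicit Defensive.
Import Order.TTheory GRing.Theory Num.Theory.
Import numFieldNormedType.Exports.
Local Open Scope classical_set_scope.
Local Open Scope ring_scope.

Definition converges (R : realType) (K : fieldType) (nm : K -> R)
    (u : nat -> K) (l : K) : Prop :=
  (fun n => nm (u n - l)) @ \oo --> (0 : R).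

Definition cauchy_seq (R : realType) (K : fieldType) (nm : K -> R)
    (u : nat -> K) : Prop :=
  forall e : R, 0 < e -> exists N : nat, forall m n : nat,
    (N <= m)%N -> (N <= n)%N -> nm (u m - u n) < e.

(* In a complete field whose norm extends the p-adic norm of rat, the closure
   of the rationals is the field Q_p. *)
Definition in_Qp (R : realType) (K : fieldType) (nm : K -> R) : set K :=
  [set x | forall e : R, 0 < e -> exists q : rat, nm (x - ratr q) < e].

Definition algebraic_over_Qp (R : realType) (K : fieldType) (nm : K -> R) :
    set K :=
  [set x | exists P : {poly K},
     [/\ P != 0, forall i : nat, in_Qp nm P`_i & root P x]].

(* (K, nm) is the field of complex p-adic numbers: the completion of an
   algebraic closure of Q_p, itself the completion of the rationals for the
   p-adic norm (normalised by |p| = 1/p).  These clauses determine (K, nm) up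
   to isometric isomorphism. *)
Record is_Cp (R : realType) (p : nat) (K : fieldType) (nm : K -> R) : Prop := {
  Cp_norm_eq0 : forall x : K, nm x = 0 <-> x = 0;
  Cp_norm_ge0 : forall x : K, 0 <= nm x;
  Cp_normM : forall x y : K, nm (x * y) = nm x * nm y;
  Cp_ultrametric : forall x y : K, nm (x + y) <= Num.max (nm x) (nm y);
  Cp_norm_nat : forall n : nat, (0 < n)%N -> nm n%:R = p%:R ^- logn p n;
  Cp_complete : forall u : nat -> K, cauchy_seq nm u ->
    exists l : K, converges nm u l;
  Cp_closed : GRing.closed_field_axiom K;
  Cp_dense : forall (x : K) (e : R), 0 < e ->
    exists2 y : K, algebraic_over_Qp nm y & nm (x - y) < e
}.

Definition Uball (R : realType) (K : fieldType) (nm : K -> R) (r : R) (c : K) :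
    set K :=
  [set x | nm (x - c) < r].

Definition Sphere (R : realType) (K : fieldType) (nm : K -> R) (r : R) (c : K) :
    set K :=
  [set x | nm (x - c) = r].

(* Partial self-maps of K are functions K -> option K, with None for
   "undefined". *)
Definition ratmap (K : fieldType) (a b d : K) (x : K) : option K :=
  if x ^+ 2 + d * x + b == 0 then None
  else Some ((a * x ^+ 2 + b * x) / (x ^+ 2 + d * x + b)).

Definition iterate (K : fieldType) (f : K -> option K) (n : nat) (x : K) :
    option K :=
  iter n (obind f) (Some x).

Definition lands_in (K : fieldType) (z : option K) (A : set K) : Prop :=
  exists2 y : K, z = Some y & A y.

Definition bad_points (K : fieldType) (f : K -> option K) (poles : set K) :
    set K :=
  [set x | exists n : nat, lands_in (iterate f n x) poles].

(* |f x|, with the junk value 0 where f is undefined. *)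
Definition norm_image (R : realType) (K : fieldType) (nm : K -> R)
    (f : K -> option K) (x : K) : R :=
  oapp nm 0 (f x).

Definition fixed_point (K : fieldType) (f : K -> option K) (x0 : K) : Prop :=
  f x0 = Some x0.

Definition has_derivative (R : realType) (K : fieldType) (nm : K -> R)
    (f : K -> option K) (x0 l : K) : Prop :=
  exists2 y0 : K, f x0 = Some y0 &
  forall e : R, 0 < e -> exists2 delta : R, 0 < delta &
  forall x : K, x != x0 -> nm (x - x0) < delta ->
  exists2 y : K, f x = Some y & nm ((y - y0) / (x - x0) - l) < e.

Definition attractive (R : realType) (K : fieldType) (nm : K -> R)
    (f : K -> option K) (x0 : K) : Prop :=
  fixed_point f x0 /\ exists2 l : K, has_derivative nm f x0 l & nm l < 1.

Definition indifferent (R : realType) (K : fieldType) (nm : K -> R)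
    (f : K -> option K) (x0 : K) : Prop :=
  fixed_point f x0 /\ exists2 l : K, has_derivative nm f x0 l & nm l = 1.

Definition basin (R : realType) (K : fieldType) (nm : K -> R)
    (f : K -> option K) (x0 : K) : set K :=
  [set x | exists2 u : nat -> K,
     forall n : nat, iterate f n x = Some (u n) & converges nm u x0].

Definition invariant_set (K : fieldType) (f : K -> option K) (A : set K) :
    Prop :=
  forall x : K, A x -> lands_in (f x) A.

Definition siegel_disk (R : realType) (K : fieldType) (nm : K -> R)
    (f : K -> option K) (x0 : K) (r : R) : Prop :=
  [/\ fixed_point f x0, 0 < r &
   forall rho : R, 0 < rho -> rho < r -> invariant_set f (Sphere nm rho x0)].

Definition SI (R : realType) (K : fieldType) (nm : K -> R)
    (f : K -> option K) (x0 : K) : set K :=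
  \bigcup_(r in [set r | siegel_disk nm f x0 r]) Uball nm r x0.

(* Main.v *)
Require Import Defs.
From mathcomp Require Import all_boot all_order all_algebra.
From mathcomp Require Import all_classical all_reals all_analysis.
From mathcomp Require Import ring.
Import Order.TTheory GRing.Theory Num.Theory.
Import numFieldNormedType.Exports.
Local Open Scope classical_set_scope.
Local Open Scope ring_scope.

(** Write [q x = x^2 + d x + b], so that [|b| = alpha^2] and [|d| <= alpha].
    Off the sphere [S_alpha(0)] the norms of [q x] and [a x + b] are bounded by the
    dominant terms: [f] preserves [|x|] inside, and sends the outside to the
    inside; on the sphere [|a x + b| = alpha^2 >= |q x|], so [|f x| >= alpha].

    Near [x2] everything follows from the exact identity
    [f x - f y = (x - y) M(x, y) / (q x q y)] with
    [M(x, y) = b (b - x y) + a (d x y + b (x + y))], whose last summand has norm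
    [< alpha^4] when [|x|, |y| <= alpha].  Thus [|f'(x2)|] is governed by
    [b - x2^2], which agrees with [b + (a - d) d] up to terms of norm
    [< alpha^2], and [f] is an isometry fixing [x2] or a contraction on
    [U_alpha(x2)] accordingly.  Siegel disks have radius at most [alpha] because
    a pole lies at distance [alpha] from the centre. *)

(** * Iteration of partial maps *)

Section PartialIteration.
Context {K : fieldType}.
Implicit Types (f : K -> option K) (A : set K) (x y z : K).

Lemma iterateS f n x : iterate f n.+1 x = obind f (iterate f n x).
Proof. by []. Qed.

Lemma iterateD f m n x y : iterate f n x = Some y ->
  iterate f (m + n) x = iterate f m y.
Proof. by move=> e; rewrite /iterate iterD -/(iterate f n x) e. Qed.

Lemma iterate_invariant f A n x :
  invariant_set f A -> A x -> lands_in (iterate f n x) A.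
Proof.
move=> hA Ax; elim: n => [|n [y ey Ay]]; first by exists x.
by rewrite iterateS ey /=; apply: hA.
Qed.

Lemma iterate_invariant_image f A n x y : invariant_set f A ->
  f x = Some y -> A y -> (1 <= n)%N -> lands_in (iterate f n x) A.
Proof.
case: n => // n hA e Ay _; rewrite -addn1 (@iterateD f n 1 x y e).
exact: iterate_invariant.
Qed.

End PartialIteration.

(** * Arithmetic of an ultrametric norm *)

Section UltrametricNorm.
Context {R : realType} {K : fieldType} (nm : K -> R).
Hypothesis nm_eq0 : forall x : K, nm x = 0 <-> x = 0.
Hypothesis nm_ge0 : forall x : K, 0 <= nm x.
Hypothesis nmM : forall x y : K, nm (x * y) = nm x * nm y.
Hypothesis nm_ultra : forall x y : K, nm (x + y) <= Num.max (nm x) (nm y).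
Implicit Types (x y z : K) (r s : R).

Lemma nm0 : nm 0 = 0.
Proof. exact/nm_eq0. Qed.

Lemma nm_neq0 x : x != 0 -> nm x != 0.
Proof. by apply: contra_neq => /nm_eq0. Qed.

Lemma nm_gt0 x : x != 0 -> 0 < nm x.
Proof. by move=> x0; rewrite lt_def nm_ge0 nm_neq0. Qed.

Lemma neq0_nm x : 0 < nm x -> x != 0.
Proof. by apply: contraTneq => ->; rewrite nm0 ltxx. Qed.

Lemma nm1 : nm 1 = 1.
Proof.
by apply: (mulfI (nm_neq0 _ (oner_neq0 K))); rewrite -nmM !mulr1.
Qed.

Lemma nmN x : nm (- x) = nm x.
Proof.
(* Squaring removes the sign, and norms are nonnegative. *)
have h : nm (- x) ^+ 2 = nm x ^+ 2 by rewrite !expr2 -!nmM mulrNN.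
by apply/eqP; rewrite -(@eqrXn2 _ 2) // h.
Qed.

Lemma nmX x n : nm (x ^+ n) = nm x ^+ n.
Proof. by elim: n => [|n IH]; rewrite ?expr0 ?nm1 // !exprS nmM IH. Qed.

Lemma nmV x : nm x^-1 = (nm x)^-1.
Proof.
have [->|x0] := eqVneq x 0; first by rewrite invr0 nm0 invr0.
by apply: (mulfI (nm_neq0 _ x0)); rewrite -nmM !mulfV ?nm1 ?nm_neq0.
Qed.

Lemma nmf_div x y : nm (x / y) = nm x / nm y.
Proof. by rewrite nmM nmV. Qed.

Lemma nm_subC x y : nm (x - y) = nm (y - x).
Proof. by rewrite -nmN opprB. Qed.

Lemma nmD_le r x y : nm x <= r -> nm y <= r -> nm (x + y) <= r.
Proof. by move=> hx hy; apply: le_trans (nm_ultra _ _) _; rewrite ge_max hx. Qed.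

Lemma nmB_le r x y : nm x <= r -> nm y <= r -> nm (x - y) <= r.
Proof. by move=> hx hy; apply: nmD_le; rewrite ?nmN. Qed.

Lemma nmD_lt r x y : nm x < r -> nm y < r -> nm (x + y) < r.
Proof. by move=> hx hy; apply: le_lt_trans (nm_ultra _ _) _; rewrite gt_max hx. Qed.

Lemma nmB_lt r x y : nm x < r -> nm y < r -> nm (x - y) < r.
Proof. by move=> hx hy; apply: nmD_lt; rewrite ?nmN. Qed.

(** Otherwise [x = (x + y) - y] would be a difference of two elements of norm below [nm x]. *)
Lemma nmDl x y : nm y < nm x -> nm (x + y) = nm x.
Proof.
move=> hyx; apply/le_anti; rewrite nmD_le ?(ltW hyx) //= leNgt.
apply/negP => hlt; have := nmB_lt _ _ _ hlt hyx.
by rewrite addrK ltxx.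
Qed.

Lemma nmDr x y : nm x < nm y -> nm (x + y) = nm y.
Proof. by rewrite addrC; apply: nmDl. Qed.

Lemma nmM_le r s x y : nm x <= r -> nm y <= s -> nm (x * y) <= r * s.
Proof. by move=> hx hy; rewrite nmM ler_pM. Qed.

Lemma nmM_ltl r s x y : 0 < s -> nm x < r -> nm y <= s -> nm (x * y) < r * s.
Proof.
move=> s0 hx hy; rewrite nmM; apply: (@le_lt_trans _ _ (nm x * s)).
  by rewrite ler_wpM2l.
by rewrite ltr_pM2r.
Qed.

Lemma nmM_ltr r s x y : 0 < r -> nm x <= r -> nm y < s -> nm (x * y) < r * s.
Proof. by move=> *; rewrite mulrC (mulrC r) nmM_ltl. Qed.

(** * Convergence and the maximal Siegel disk *)

Lemma converges_norm_lt (u : nat -> K) x r : converges nm u x -> 0 < r ->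
  exists n, nm (u n - x) < r.
Proof.
move=> /cvgrPdist_lt /(_ r) h /h [n _ /(_ n (leqnn n))].
by rewrite /= sub0r normrN (ger0_norm (nm_ge0 _)) => ?; exists n.
Qed.

Lemma converges_geometric (u : nat -> K) x r s : 0 <= s -> s < 1 ->
  (forall n, nm (u n - x) <= r * s ^+ n) -> converges nm u x.
Proof.
move=> s0 s1 h; apply: (@squeeze_cvgr _ _ _ _ (fun=> 0) (fun n => r * s ^+ n)).
- by near=> n; rewrite nm_ge0 h.
- exact: cvg_cst.
- rewrite -[X in _ --> X](mulr0 r); apply: cvgMl_tmp; apply: cvg_expr.
  by rewrite ger0_norm.
Unshelve. all: by end_near. Qed.

(* The pole at distance [r] prevents any Siegel disk from being larger. *)
Lemma SI_eq_ball (f : K -> option K) x0 h r :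
  fixed_point f x0 -> 0 < r ->
  (forall x, nm (x - x0) < r ->
     exists2 y, f x = Some y & nm (y - x0) = nm (x - x0)) ->
  f h = None -> nm (h - x0) = r ->
  SI nm f x0 = Uball nm r x0.
Proof.
move=> fx0 r0 isof fh hr; apply/seteqP; split=> x /=.
  case=> s [_ s0 hs]; rewrite /Uball /= => hx; apply: lt_le_trans hx _.
  rewrite leNgt; apply/negP => rs.
  by have [y] := hs r r0 rs h hr; rewrite fh.
move=> hx; exists r => //; split=> // rho rho0 rhor y hy.
have [|z ez hz] := isof y; first by rewrite hy.
by exists z; rewrite // /Sphere /= hz.
Qed.

(** * Norms of the denominator and of the numerator factor [a * x + b] *)

Section QuadraticRationalMap.
Variables (a b d : K) (alpha : R).
Hypothesis alpha_gt0 : 0 < alpha.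
Hypothesis nma : nm a < alpha.
Hypothesis nmb : nm b = alpha ^+ 2.
Hypothesis nmd : nm d <= alpha.

Local Notation f := (ratmap a b d).
Local Notation den x := (x ^+ 2 + d * x + b).
Local Notation val x := ((a * x ^+ 2 + b * x) / den x).

Lemma ratmap_def x : den x != 0 -> f x = Some (val x).
Proof. by rewrite /ratmap => /negbTE ->. Qed.

Lemma den_le x : nm x <= alpha -> nm (den x) <= alpha ^+ 2.
Proof.
move=> hx; rewrite !expr2; apply: nmD_le; last by rewrite nmb expr2.
by apply: nmD_le; apply: nmM_le.
Qed.

Lemma den_inner x : nm x < alpha -> nm (den x) = alpha ^+ 2.
Proof.
move=> hx; rewrite nmDr ?nmb // !expr2; apply: nmD_lt; last exact: nmM_ltr.
by apply: nmM_ltl => //; apply: ltW.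
Qed.

Lemma den_outer x : alpha < nm x -> nm (den x) = nm x ^+ 2.
Proof.
move=> hx; have x0 : 0 < nm x := lt_trans alpha_gt0 hx.
rewrite -addrA nmDl ?nmX //; apply: nmD_lt.
  by rewrite expr2; apply: nmM_ltl => //; apply: le_lt_trans nmd hx.
by rewrite nmb; apply: ltrXn2r => //; rewrite ltW.
Qed.

(** The two denominators differ by a multiple of [x - x0] with cofactor of norm at most [alpha], so
    the difference is too small to change the norm. *)
Lemma den_near x x0 : nm x <= alpha -> nm x0 <= alpha ->
  nm (x - x0) < alpha -> nm (den x0) = alpha ^+ 2 -> nm (den x) = alpha ^+ 2.
Proof.
move=> hx hx0 hxx0 hq.
have -> : den x = den x0 + (x - x0) * (x + x0 + d) by ring.
rewrite nmDl // hq expr2; apply: nmM_ltl => //.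
by apply: nmD_le => //; apply: nmD_le.
Qed.

Lemma num_factor_norm x : nm x <= alpha -> nm (a * x + b) = alpha ^+ 2.
Proof. by move=> hx; rewrite nmDr ?nmb // expr2; apply: nmM_ltl. Qed.

Lemma valE x : val x = x * (a * x + b) / den x.
Proof. by congr (_ / _); ring. Qed.

Lemma den_neq0 x r : 0 < r -> nm (den x) = r ^+ 2 -> den x != 0.
Proof. by move=> r0 h; apply: neq0_nm; rewrite h exprn_gt0. Qed.

(** * Dynamics off the sphere of radius [alpha] *)

Lemma ratmap_inner x : nm x < alpha ->
  exists2 y, f x = Some y & nm y = nm x.
Proof.
move=> hx; have hd := den_inner _ hx; exists (val x).
  exact/ratmap_def/(den_neq0 _ _ alpha_gt0 hd).
rewrite valE nmf_div nmM hd num_factor_norm ?(ltW hx) // mulfK //.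
by rewrite expf_neq0 // gt_eqF.
Qed.

Lemma inner_sphere_invariant r :
  r < alpha -> invariant_set f (Sphere nm r 0).
Proof.
move=> hr x; rewrite /Sphere /= subr0 => hx.
have [|y ey hy] := ratmap_inner x; first by rewrite hx.
by exists y => //=; rewrite subr0 hy.
Qed.

(** The norm of [a * x + b] stays unevaluated: when [nm x = alpha ^+ 2 / nm a], its two terms have
    equal norm and may cancel. *)
Lemma ratmap_outer x : alpha < nm x ->
  exists2 y, f x = Some y & nm y = nm (a * x + b) / nm x.
Proof.
move=> hx; have x0 : 0 < nm x := lt_trans alpha_gt0 hx.
have hd := den_outer _ hx; exists (val x).
  exact/ratmap_def/(den_neq0 _ _ x0 hd).
by rewrite valE nmf_div nmM hd; field; rewrite gt_eqF.
Qed.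

Lemma iterate_inner n x y : f x = Some y -> nm y < alpha -> (1 <= n)%N ->
  lands_in (iterate f n x) (Sphere nm (nm y) 0).
Proof.
move=> ey hy; apply: iterate_invariant_image ey _.
  exact: inner_sphere_invariant.
by rewrite /Sphere /= subr0.
Qed.

Hypothesis a_neq0 : a != 0.

Lemma ratmap_outer_lt x y : alpha < nm x -> f x = Some y -> nm y < alpha.
Proof.
move=> hx ey; have x0 : 0 < nm x := lt_trans alpha_gt0 hx.
have [z ez hz] := ratmap_outer _ hx.
move: ez; rewrite ey => -[->]; rewrite hz ltr_pdivrMr //.
apply: nmD_lt; first by rewrite nmM ltr_pM2r.
by rewrite nmb expr2 ltr_pM2l.
Qed.

(** One step leads inside, where [f] preserves the norm, so only the norm of the first image
    matters. In the three cases [b] dominates [a * x], ties with it, or is dominated by it. *)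
Lemma iterate_outer n x : alpha < nm x -> (1 <= n)%N ->
  [/\ alpha < nm x < alpha ^+ 2 / nm a ->
        lands_in (iterate f n x) (Sphere nm (alpha ^+ 2 / nm x) 0),
      nm x = alpha ^+ 2 / nm a ->
        lands_in (iterate f n x) (Sphere nm (norm_image nm f x) 0) &
      alpha ^+ 2 / nm a < nm x ->
        lands_in (iterate f n x) (Sphere nm (nm a) 0)].
Proof.
move=> hx n1; have x0 : 0 < nm x := lt_trans alpha_gt0 hx.
have [y ey hy] := ratmap_outer _ hx.
have H := iterate_inner n _ _ ey (ratmap_outer_lt _ _ hx ey) n1.
have a0 := nm_gt0 _ a_neq0.
split.
- case/andP=> _; rewrite ltr_pdivlMr // => hlt.
  suff <- : nm y = alpha ^+ 2 / nm x by [].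
  by rewrite hy nmDr ?nmb // nmM mulrC.
- by move=> _; rewrite /norm_image ey.
- rewrite ltr_pdivrMr // => hlt.
  suff <- : nm y = nm a by [].
  by rewrite hy nmDl nmM ?nmb ?mulfK ?gt_eqF // mulrC.
Qed.

(** * Trajectories meeting the sphere of radius [alpha] *)

Lemma ratmap_sphere x y : nm x = alpha -> f x = Some y -> alpha <= nm y.
Proof.
move=> hx; rewrite /ratmap; case: eqP => // /eqP q0 [<-].
rewrite valE nmf_div nmM num_factor_norm ?hx //.
rewrite ler_pdivlMr ?nm_gt0 // ler_pM2l //.
by apply: den_le; rewrite hx.
Qed.

(** No orbit enters the sphere from elsewhere: inner spheres are invariant, and an outer point falls
    inside after one step and stays there. *)
Lemma iterate_off_sphere n x y : iterate f n x = Some y -> nm y = alpha ->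
  nm x = alpha.
Proof.
move=> ey hy; case: (ltgtP (nm x) alpha) => // hx; exfalso.
  have [|z ez hz] := iterate_invariant f (Sphere nm (nm x) 0) n x
    (inner_sphere_invariant _ hx); first by rewrite /Sphere /= subr0.
  case: (etrans (esym ez) ey) => e; move: hz hx.
  by rewrite /Sphere /= subr0 e hy => <-; rewrite ltxx.
case: n ey => [[e]|n ey]; first by move: hx; rewrite e hy ltxx.
have [z ez hz] := ratmap_outer _ hx.
have hlt := ratmap_outer_lt _ _ hx ez.
have [w ew hw] := iterate_inner n.+1 _ _ ez hlt isT.
case: (etrans (esym ew) ey) => e; move: hw hlt.
by rewrite /Sphere /= subr0 e hy => <-; rewrite ltxx.
Qed.

(** In the first case [k] is the first exit time. The exit is outwards, because the preceding point
    lies on the sphere, where [f] cannot decrease the norm. *)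
Lemma iterate_sphere_dichotomy x : nm x = alpha ->
  (forall n, iterate f n x <> None) ->
  (exists k y, [/\ (1 <= k)%N, iterate f k x = Some y, alpha < nm y &
     forall m, (m <= k - 1)%N -> lands_in (iterate f m x) (Sphere nm alpha 0)])
  \/ (forall k, lands_in (iterate f k x) (Sphere nm alpha 0)).
Proof.
move=> hx xdef.
(* The boolean exit test allows a least exit time to be chosen. Its default value 0 for an undefined
   iterate never occurs, by [xdef]. *)
have onS m : (oapp nm 0 (iterate f m x) != alpha) = false ->
    lands_in (iterate f m x) (Sphere nm alpha 0).
  move/negbFE/eqP; case e: (iterate f m x) => [y|] /=; last by have := xdef m.
  by move=> hy; exists y => //; rewrite /Sphere /= subr0.
have [ex|nex] := pselect (exists k, oapp nm 0 (iterate f k x) != alpha);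
  last first.
  by right=> k; apply: onS; apply/negbTE/negP => hk; apply: nex; exists k.
left; case: (ex_minnP ex) => -[|k]; first by rewrite /= hx eqxx.
have onSm m : (m <= k)%N -> (forall n, oapp nm 0 (iterate f n x) != alpha ->
    (k < n)%N) -> lands_in (iterate f m x) (Sphere nm alpha 0).
  move=> mk kmin; apply: onS; apply/negbTE/negP => /kmin.
  by rewrite ltnNge mk.
move=> hk kmin; have [z ez hz] := onSm _ (leqnn k) kmin.
move: hk; case e: (iterate f k.+1 x) => [y|] /=; last by have := xdef k.+1.
move=> hy; exists k.+1, y; split=> //.
  rewrite lt_def hy; apply: (ratmap_sphere z).
    by move: hz; rewrite /Sphere /= subr0.
  by move: e; rewrite iterateS ez.
by move=> m; rewrite subn1 /= => mk; apply: onSm.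
Qed.

(** * Difference quotients and the derivative *)

Local Notation slope x y :=
  (b * (b - x * y) + a * (d * (x * y) + b * (x + y))).

(** [slope] is the [M] of the exact identity; on the diagonal, divided by the squared denominator,
    it is the derivative. *)
Lemma val_sub x y : den x != 0 -> den y != 0 ->
  val x - val y = (x - y) * (slope x y / (den x * den y)).
Proof. by move=> hx hy; field; rewrite hx hy. Qed.

Lemma slope_small x y : nm x <= alpha -> nm y <= alpha ->
  nm (a * (d * (x * y) + b * (x + y))) < alpha ^+ 4.
Proof.
move=> hx hy; have -> : alpha ^+ 4 = alpha * (alpha ^+ 3) by ring.
apply: nmM_ltl => //; first by rewrite exprn_gt0.
apply: nmD_le.
  have -> : alpha ^+ 3 = alpha * (alpha * alpha) by ring.
  by apply: nmM_le => //; apply: nmM_le.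
have -> : alpha ^+ 3 = alpha ^+ 2 * alpha by ring.
by apply: nmM_le; [rewrite nmb | apply: nmD_le].
Qed.

(** Here [b * b] strictly dominates. Taken at [x2] when [nm d < alpha], this makes the multiplier a
    unit. *)
Lemma slope_inner x y : nm x < alpha -> nm y < alpha ->
  nm (slope x y) = alpha ^+ 4.
Proof.
move=> hx hy; have hs := slope_small x y (ltW hx) (ltW hy).
have e : nm (b * (b - x * y)) = alpha ^+ 4.
  rewrite nmM nmDl ?nmb; first by ring.
  by rewrite nmN expr2; apply: nmM_ltl => //; apply: ltW.
by rewrite nmDl e.
Qed.

Lemma slope_near x y : nm x <= alpha -> nm y <= alpha ->
  nm (slope x y - slope y y) <= alpha ^+ 3 * nm (x - y).
Proof.
move=> hx hy.
have -> : slope x y - slope y y = (a * d * y + b * (a - y)) * (x - y) by ring.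
apply: nmM_le => //; have -> : alpha ^+ 3 = alpha * alpha * alpha by ring.
have ha := ltW nma.
apply: nmD_le; first by apply: nmM_le => //; apply: nmM_le.
by apply: nmM_le; [rewrite nmb expr2 | apply: nmB_le].
Qed.

(* On the ball [U_alpha(x0)] the difference quotient at [x0] is Lipschitz
   with constant [1 / alpha]. *)
Lemma ratmap_has_derivative x0 : nm x0 <= alpha -> nm (den x0) = alpha ^+ 2 ->
  has_derivative nm f x0 (slope x0 x0 / (den x0 * den x0)).
Proof.
move=> hx0 hq; have q0 := den_neq0 _ _ alpha_gt0 hq.
exists (val x0); first exact: ratmap_def.
(* The bound [alpha] fixes the norm of the denominator at [x]; the bound [e * alpha] offsets the
   Lipschitz constant. *)
move=> e e0; exists (Num.min alpha (e * alpha)).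
  by rewrite lt_min alpha_gt0 mulr_gt0.
move=> x xx0; rewrite lt_min => /andP[hx he].
have hxa : nm x <= alpha.
  by rewrite -(subrK x0 x); apply: nmD_le => //; apply: ltW.
have hqx := den_near x x0 hxa hx0 hx hq.
have qx := den_neq0 _ _ alpha_gt0 hqx.
exists (val x); first exact: ratmap_def.
have dx : x - x0 != 0 by rewrite subr_eq0.
rewrite val_sub // [X in X / _]mulrC mulfK //.
set s := slope x x0; set s0 := slope x0 x0.
(* The second product in the numerator is [s0 * (den x - den x0)]. The numerator has norm at most
   [nm (x - x0) * alpha ^+ 5], the common denominator norm [alpha ^+ 6]. *)
have -> : s / (den x * den x0) - s0 / (den x0 * den x0) =
    ((s - s0) * den x0 - s0 * ((x - x0) * (x + x0 + d))) /
    (den x * den x0 * den x0) by field; rewrite qx q0.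
rewrite nmf_div !nmM hqx hq ltr_pdivrMr ?mulr_gt0 ?exprn_gt0 //.
apply: (@le_lt_trans _ _ (nm (x - x0) * alpha ^+ 5)); last first.
  have -> : e * (alpha ^+ 2 * alpha ^+ 2 * alpha ^+ 2) =
    (e * alpha) * alpha ^+ 5 by ring.
  by rewrite ltr_pM2r // exprn_gt0.
apply: nmB_le.
  have -> : nm (x - x0) * alpha ^+ 5 = alpha ^+ 3 * nm (x - x0) * alpha ^+ 2.
    by ring.
  by apply: nmM_le; [apply: slope_near | rewrite hq].
have -> : nm (x - x0) * alpha ^+ 5 = alpha ^+ 4 * (nm (x - x0) * alpha) by ring.
apply: nmM_le.
  apply: nmD_le; last exact/ltW/slope_small.
  have -> : alpha ^+ 4 = alpha ^+ 2 * (alpha * alpha) by ring.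
  apply: nmM_le; first by rewrite nmb.
  by apply: nmB_le; [rewrite nmb expr2 | apply: nmM_le].
by apply: nmM_le => //; apply: nmD_le => //; apply: nmD_le.
Qed.

Lemma ratmap_near x0 x : nm x0 <= alpha -> nm (den x0) = alpha ^+ 2 ->
  nm (x - x0) < alpha -> f x0 = Some x0 ->
  exists2 y, f x = Some y &
    nm (y - x0) = nm (x - x0) * (nm (slope x x0) / alpha ^+ 4).
Proof.
move=> hx0 hq hx fx0; have q0 := den_neq0 _ _ alpha_gt0 hq.
have hxa : nm x <= alpha.
  by rewrite -(subrK x0 x); apply: nmD_le => //; apply: ltW.
have hqx := den_near x x0 hxa hx0 hx hq.
have qx := den_neq0 _ _ alpha_gt0 hqx.
exists (val x); first exact: ratmap_def.
have ex0 : val x0 = x0 by move: fx0; rewrite ratmap_def // => -[].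
rewrite -[in LHS]ex0 val_sub // nmM nmf_div (nmM (den x)) hqx hq.
by rewrite -exprD.
Qed.

(** * The fixed point [x2] and its multiplier *)

Local Notation x2 := (a - d).

Lemma x2_le : nm x2 <= alpha.
Proof. by apply: nmB_le => //; apply: ltW. Qed.

Lemma den_x2 : nm (den x2) = alpha ^+ 2.
Proof.
(* Since [x2 + d = a], the denominator at [x2] equals the numerator factor, whose norm is known. *)
have -> : den x2 = a * x2 + b by ring.
by rewrite num_factor_norm // x2_le.
Qed.

Lemma ratmap_fixed_x2 : fixed_point f x2.
Proof.
have q0 := den_neq0 _ _ alpha_gt0 den_x2.
rewrite /fixed_point ratmap_def //; congr Some; apply: (canLR (mulfK q0)).
by ring.
Qed.

(** From [x2 ^+ 2 = a * x2 - d * x2], the leading factor [b - x2 ^+ 2] is [b + x2 * d] up to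
    [a * x2], and every remaining term carries the small factor [a]. *)
Lemma slope_x2_approx :
  nm (slope x2 x2 - b * (b + x2 * d)) < alpha ^+ 4.
Proof.
have -> : slope x2 x2 - b * (b + x2 * d) =
    a * (d * (x2 * x2) + b * (x2 + x2)) - a * (x2 * b) by ring.
have h := x2_le; apply: nmB_lt; first exact: slope_small.
have -> : alpha ^+ 4 = alpha * (alpha * alpha ^+ 2) by ring.
apply: nmM_ltl => //; first by rewrite mulr_gt0 ?exprn_gt0.
by apply: nmM_le; rewrite ?nmb.
Qed.

Lemma slope_x2_lt :
  nm (b + x2 * d) < alpha ^+ 2 -> nm (slope x2 x2) < alpha ^+ 4.
Proof.
move=> h; rewrite -[slope x2 x2](subrK (b * (b + x2 * d))).
apply: nmD_lt slope_x2_approx _.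
have -> : alpha ^+ 4 = alpha ^+ 2 * alpha ^+ 2 by ring.
by apply: nmM_ltr; rewrite ?nmb ?exprn_gt0.
Qed.

Lemma slope_x2_eq :
  nm (b + x2 * d) = alpha ^+ 2 -> nm (slope x2 x2) = alpha ^+ 4.
Proof.
move=> h; have e : nm (b * (b + x2 * d)) = alpha ^+ 4.
  by rewrite nmM nmb h -exprD.
by rewrite -[slope x2 x2](subrK (b * (b + x2 * d))) nmDr e // slope_x2_approx.
Qed.

Lemma ratmap_derivative_x2 : exists2 l,
  has_derivative nm f x2 l & nm l = nm (slope x2 x2) / alpha ^+ 4.
Proof.
exists (slope x2 x2 / (den x2 * den x2)).
  by apply: ratmap_has_derivative; [apply: x2_le | apply: den_x2].
by rewrite nmf_div (nmM (den x2)) den_x2 -exprD.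
Qed.

Lemma slope_near_x2_le x r : nm (x - x2) < alpha ->
  nm (slope x2 x2) <= r -> alpha ^+ 3 * nm (x - x2) <= r ->
  nm (slope x x2) <= r.
Proof.
move=> hx h1 h2; rewrite -[slope x x2](subrK (slope x2 x2)).
apply: nmD_le => //; apply: le_trans h2; apply: slope_near; last exact: x2_le.
by rewrite -(subrK x2 x); apply: nmD_le; [apply: ltW | apply: x2_le].
Qed.

Lemma slope_near_x2_eq x : nm (x - x2) < alpha ->
  nm (slope x2 x2) = alpha ^+ 4 -> nm (slope x x2) = alpha ^+ 4.
Proof.
move=> hx h; rewrite -[slope x x2](subrK (slope x2 x2)) nmDr h //.
apply: (@le_lt_trans _ _ (alpha ^+ 3 * nm (x - x2))).
  apply: slope_near; last exact: x2_le.
  by rewrite -(subrK x2 x); apply: nmD_le; [apply: ltW | apply: x2_le].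
by rewrite (exprSr alpha 3) ltr_pM2l // exprn_gt0.
Qed.

(** * The basin of attraction of [x2] *)

Lemma ball_x2_sphere : nm x2 = alpha ->
  Uball nm alpha x2 `<=` Sphere nm alpha 0.
Proof.
move=> h x; rewrite /Uball /Sphere /= subr0 => hx.
by rewrite -(subrK x2 x) nmDr h.
Qed.

Lemma ball_x2_sub_basin : nm (slope x2 x2) < alpha ^+ 4 ->
  Uball nm alpha x2 `<=` basin nm f x2.
Proof.
move=> hs x; rewrite /Uball /= => hx; set rho := nm (x - x2) in hx.
have a4 : 0 < alpha ^+ 4 by rewrite exprn_gt0.
(* A contraction ratio valid within distance [rho] of [x2]: the slope there differs from its value
   at [x2] by at most [alpha ^+ 3 * rho], and both bounds are divided by [alpha ^+ 4]. *)
pose s := Num.max (nm (slope x2 x2) / alpha ^+ 4) (rho / alpha).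
have s0 : 0 <= s by rewrite le_max !divr_ge0 ?nm_ge0 ?(ltW alpha_gt0) ?(ltW a4).
have s1 : s < 1 by rewrite gt_max !ltr_pdivrMr // !mul1r hs.
have H n : exists2 y, iterate f n x = Some y & nm (y - x2) <= rho * s ^+ n.
  elim: n => [|n [y ey hy]]; first by exists x; rewrite // expr0 mulr1.
  have hyr : nm (y - x2) <= rho.
    by apply: le_trans hy _; rewrite ler_piMr ?nm_ge0 // exprn_ile1 // ltW.
  have hya := le_lt_trans hyr hx.
  have [z ez hz] := ratmap_near x2 y x2_le den_x2 hya ratmap_fixed_x2.
  exists z; first by rewrite iterateS ey.
  rewrite hz (exprSr s) [leRHS]mulrA; apply: ler_pM; rewrite ?divr_ge0 ?(ltW a4) //.
  rewrite ler_pdivrMr //; apply: slope_near_x2_le => //.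
    by rewrite -ler_pdivrMr // le_max lexx.
  apply: (@le_trans _ _ (rho / alpha * alpha ^+ 4)); last first.
    by rewrite ler_pM2r // le_max lexx orbT.
  have -> : rho / alpha * alpha ^+ 4 = alpha ^+ 3 * rho.
    by field; rewrite gt_eqF.
  by rewrite ler_pM2l // exprn_gt0.
(* The default 0 is never taken, since [H] shows that every iterate is defined. *)
exists (fun n => odflt 0 (iterate f n x)).
  by move=> n; have [y ->] := H n.
apply: (converges_geometric _ _ rho s) => // n.
by have [y ->] := H n.
Qed.

(* Modulo smaller terms [b = x2 ^+ 2], so [slope x x2 = b * x2 * (x2 - x)]:
   in the reduction, [x2] is the only preimage of [x2]. *)
Lemma ratmap_preimage_ball_x2 x y : nm x2 = alpha ->
  nm (b + x2 * d) < alpha ^+ 2 ->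
  f x = Some y -> nm (y - x2) < alpha -> nm (x - x2) < alpha.
Proof.
move=> hx2 hb ey hy.
have hya : nm y = alpha by rewrite -(subrK x2 y) nmDr hx2.
have hx : nm x = alpha by apply: (iterate_off_sphere 1 x y).
have hxle : nm (x - x2) <= alpha by apply: nmB_le; rewrite ?hx ?hx2.
(* By contradiction: at distance exactly [alpha], the term [b * x2 * (x2 - x)] gives the slope norm
   [alpha ^+ 4]. As [nm (den x) <= alpha ^+ 2], the image is then at distance at least [alpha] from
   [x2]. *)
rewrite lt_neqAle hxle andbT; apply/eqP => hxx2.
move: ey; rewrite /ratmap; case: eqP => // /eqP qx [ey].
have q2 := den_neq0 _ _ alpha_gt0 den_x2.
have ex2 : val x2 = x2.
  by move: ratmap_fixed_x2; rewrite /fixed_point ratmap_def // => -[].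
have hs : nm (slope x x2) = alpha ^+ 4.
  have -> : slope x x2 = b * (x2 * (x2 - x)) +
      (b * (b + x2 * d - a * x2) + a * (d * (x * x2) + b * (x + x2))) by ring.
  have e : nm (b * (x2 * (x2 - x))) = alpha ^+ 4.
    by rewrite !nmM nmb hx2 nm_subC hxx2; ring.
  rewrite nmDl e //; apply: nmD_lt; last by apply: slope_small; rewrite ?hx ?hx2.
  have -> : alpha ^+ 4 = alpha ^+ 2 * alpha ^+ 2 by ring.
  apply: nmM_ltr; rewrite ?nmb ?exprn_gt0 //.
  by apply: nmB_lt => //; rewrite expr2; apply: nmM_ltl; rewrite ?hx2.
move: hy; apply/negP; rewrite -leNgt -ey -[X in _ - X]ex2 val_sub //.
rewrite nmM nmf_div (nmM (den x)) hs den_x2 hxx2 ler_peMr ?(ltW alpha_gt0) //.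
rewrite ler_pdivlMr ?mulr_gt0 ?nm_gt0 ?exprn_gt0 // mul1r.
by rewrite (exprD alpha 2 2) ler_pM2r ?exprn_gt0 // den_le // hx.
Qed.

(** Convergence brings the orbit into the ball at some time [n]; since preimages of points of the
    ball lie in the ball, going back [n] steps puts [x] there. *)
Lemma basin_x2 : nm x2 = alpha -> nm (b + x2 * d) < alpha ^+ 2 ->
  basin nm f x2 = Uball nm alpha x2.
Proof.
move=> hx2 hb; apply/seteqP; split; last first.
  exact/ball_x2_sub_basin/slope_x2_lt.
move=> x [u hu /converges_norm_lt - /(_ _ alpha_gt0) [n]].
move: (u n) (hu n) => y; elim: n y => [|n IH] y; first by case=> ->.
rewrite iterateS; case e: (iterate f n x) => [z|] //= ez hy.
exact: IH e (ratmap_preimage_ball_x2 _ _ hx2 hb ez hy).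
Qed.

(** * Poles and maximal Siegel disks *)

Variables (h1 h2 : K).
Hypothesis den_roots : forall x, den x = (x - h1) * (x - h2).
Hypothesis nmh1 : nm h1 = alpha.
Hypothesis nmh2 : nm h2 = alpha.

Lemma ratmap_pole1 : f h1 = None.
Proof. by rewrite /ratmap den_roots subrr mul0r eqxx. Qed.

(** The two factors of [den x0] have norm at most [alpha] and product of norm [alpha ^+ 2], so
    neither can be smaller. *)
Lemma pole_distance x0 : nm x0 <= alpha -> nm (den x0) = alpha ^+ 2 ->
  nm (h1 - x0) = alpha.
Proof.
move=> hx0; rewrite den_roots nmM (nm_subC x0 h1) expr2 => e.
have l1 : nm (h1 - x0) <= alpha by apply: nmB_le; rewrite ?nmh1.
have l2 : nm (x0 - h2) <= alpha by apply: nmB_le; rewrite ?nmh2.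
apply/le_anti; rewrite l1 /= -(ler_pM2r alpha_gt0) -e.
by rewrite ler_wpM2l ?nm_ge0.
Qed.

Lemma SI_0 : SI nm f 0 = Uball nm alpha 0.
Proof.
apply: (SI_eq_ball _ _ h1) => //.
- have [|y ey] := ratmap_inner 0; first by rewrite nm0.
  by rewrite nm0 /fixed_point ey => /nm_eq0 ->.
- move=> x; rewrite subr0 => /ratmap_inner[y ey hy].
  by exists y; rewrite ?subr0.
- exact: ratmap_pole1.
- by rewrite subr0.
Qed.

Lemma SI_x2 : nm (slope x2 x2) = alpha ^+ 4 ->
  SI nm f x2 = Uball nm alpha x2.
Proof.
move=> hs; apply: (SI_eq_ball _ _ h1) => //.
- exact: ratmap_fixed_x2.
- move=> x hx.
  have [y ey hy] := ratmap_near x2 x x2_le den_x2 hx ratmap_fixed_x2.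
  exists y => //; rewrite hy slope_near_x2_eq // divff ?mulr1 //.
  by rewrite expf_neq0 // gt_eqF.
- exact: ratmap_pole1.
- exact: pole_distance x2_le den_x2.
Qed.

Lemma bad_points_sphere :
  bad_points f [set h1; h2] `<=` Sphere nm alpha 0.
Proof.
move=> x [n [y ey hy]]; rewrite /Sphere /= subr0.
by apply: iterate_off_sphere ey _; case: hy => ->.
Qed.

Lemma iterate_not_bad x n : ~ bad_points f [set h1; h2] x ->
  iterate f n x <> None.
Proof.
move=> hx; elim: n => // n; rewrite iterateS.
case e: (iterate f n x) => [y|] // _ /=.
rewrite /ratmap den_roots; case: eqP => // /eqP.
rewrite mulf_eq0 !subr_eq0 => hy; exfalso; apply: hx.
by exists n, y => //; case/orP: hy => /eqP ->; [left|right].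
Qed.

End QuadraticRationalMap.
End UltrametricNorm.

(** * Assembly of the five assertions *)

Theorem theorem1 (R : realType) (p : nat) (K : fieldType) (nm : K -> R)
    (hp : prime p) (hK : is_Cp p nm)
    (a b d hx1 hx2 : K)
    (hab : a * b != 0) (had : a != d)
    (hroots : 'X^2 + d%:P * 'X + b%:P = ('X - hx1%:P) * ('X - hx2%:P))
    (hfix : b + a * (a - d) != 0)
    (alpha beta : R) (halpha : alpha = nm hx1) (hbeta : beta = nm hx2)
    (hle : alpha <= beta)
    (ha : nm a < alpha) (heq : alpha = beta) :
  let f := ratmap a b d in
  let x1 : K := 0 in
  let x2 : K := a - d in
  let PP := bad_points f [set hx1; hx2] in
  let S := fun r : R => Sphere nm r 0 in
  let astar := norm_image nm f in
  [/\ (* 1 *)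
      SI nm f x1 = Uball nm alpha 0 /\ PP `<=` S alpha,
      (* 2 *)
      forall (r : R) (x : K), alpha < r -> S r x ->
      forall n : nat, (1 <= n)%N ->
        [/\ alpha < r < alpha ^+ 2 / nm a ->
              lands_in (iterate f n x) (S (alpha ^+ 2 / r)),
            r = alpha ^+ 2 / nm a ->
              lands_in (iterate f n x) (S (astar x)) &
            alpha ^+ 2 / nm a < r ->
              lands_in (iterate f n x) (S (nm a))],
      (* 3 *)
      forall x : K, (S alpha `\` PP) x ->
        (exists (k : nat) (mu : R) (y : K),
          [/\ (1 <= k)%N, alpha < mu, iterate f k x = Some y /\ S mu y,
              forall m : nat, (k + 1 <= m)%N ->
                [/\ alpha < mu < alpha ^+ 2 / nm a ->
                      lands_in (iterate f m x) (S (alpha ^+ 2 / mu)),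
                    mu = alpha ^+ 2 / nm a ->
                      lands_in (iterate f m x) (S (astar y)) &
                    alpha ^+ 2 / nm a < mu ->
                      lands_in (iterate f m x) (S (nm a))] &
              forall m : nat, (m <= k - 1)%N ->
                lands_in (iterate f m x) (S alpha)])
        \/
        (forall k : nat, (1 <= k)%N -> lands_in (iterate f k x) (S alpha)),
      (* 4 *)
      nm d < alpha ->
        (exists2 l : K, has_derivative nm f x2 l & nm l = 1) /\
        SI nm f x2 = SI nm f x1 &
      (* 5 *)
      nm d = alpha ->
        [/\ S alpha x2,
            nm (b + (a - d) * d) < alpha ^+ 2 ->
              [/\ attractive nm f x2,
                  basin nm f x2 = Uball nm alpha x2 &
                  Uball nm alpha x2 `<=` S alpha] &
            nm (b + (a - d) * d) = alpha ^+ 2 ->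
              [/\ indifferent nm f x2,
                  SI nm f x2 = Uball nm alpha x2 &
                  Uball nm alpha x2 `<=` S alpha]]].
Proof.
case: hK => nm_eq0 nm_ge0 nmM nm_ultra _ _ _ _ f x1 x2 PP S astar.
have nmh2 : nm hx2 = alpha by rewrite heq hbeta.
have a0 : a != 0 by apply: contraNneq hab => ->; rewrite mul0r.
have alpha0 : 0 < alpha := le_lt_trans (nm_ge0 a) ha.
have roots x : x ^+ 2 + d * x + b = (x - hx1) * (x - hx2).
  by have := congr1 (horner^~ x) hroots; rewrite !hornerE.
(* The coefficients in terms of the roots: the factorisation is evaluated at 0 for [b], then at 1
   for [d]. *)
have eb : b = hx1 * hx2 by have := roots 0; rewrite expr0n mulr0 !add0r mulrNN.
have nmb : nm b = alpha ^+ 2 by rewrite eb nmM -halpha nmh2.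
have ed : d = - hx1 - hx2.
  have -> : d = (1 ^+ 2 + d * 1 + b) - 1 - b by ring.
  by rewrite roots eb; ring.
have nmd : nm d <= alpha.
  by rewrite ed; apply: nmB_le; rewrite // ?nmN // -?halpha ?nmh2.
have nmh1 := esym halpha.
have outer : forall y n, alpha < nm y -> (1 <= n)%N -> _ :=
  fun y n => iterate_outer nm nm_eq0 nm_ge0 nmM nm_ultra
    a b d alpha alpha0 ha nmb nmd a0 n y.
have x2_norm : nm d = alpha -> nm x2 = alpha.
  by move=> e; rewrite /x2 addrC nmDl ?nmN ?e.
have [l hl nml] := ratmap_derivative_x2 nm nm_eq0 nm_ge0 nmM nm_ultra a b d
  alpha alpha0 ha nmb nmd.
have SI0 : SI nm f 0 = Uball nm alpha 0 by apply: SI_0 roots nmh1.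
split.
- split=> //; exact: (bad_points_sphere nm).
- move=> r x hr; rewrite /S /Sphere /= subr0 => hx n n1.
  by rewrite -hx in hr *; apply: outer.
- move=> x; rewrite /S /Sphere /= subr0 => -[hx nPP].
  have [|[k [y [k1 ey hy hk]]]|h] := iterate_sphere_dichotomy nm nm_eq0
    nm_ge0 nmM nm_ultra a b d alpha alpha0 ha nmb nmd x hx.
  + by move=> n; apply: iterate_not_bad roots _ n nPP.
  + left; exists k, (nm y), y; split=> //; first by rewrite subr0.
    move=> m; rewrite addn1 => km.
    (* The orbit restarts at the exit point [y], with [m - k >= 1] steps left. *)
    rewrite -(subnK (ltnW km)) (iterateD _ _ _ _ _ ey).
    by apply: outer => //; rewrite subn_gt0.
  + by right=> k _; apply: h.
- move=> hd; have x2lt : nm x2 < alpha by apply: nmB_lt.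
  have hs := slope_inner nm nm_ge0 nmM nm_ultra a b d alpha alpha0 ha nmb nmd
    x2 x2 x2lt x2lt.
  split.
    by exists l; rewrite // nml hs divff // expf_neq0 // gt_eqF.
  rewrite SI0 (SI_x2 nm nm_eq0 nm_ge0 nmM nm_ultra a b d alpha alpha0 ha nmb
    nmd hx1 hx2) //.
  (* Since [nm x2 < alpha], the balls of radius [alpha] about [x2] and 0 coincide. *)
  apply/seteqP; split=> x; rewrite /Uball /= subr0 => hx.
    by rewrite -(subrK x2 x); apply: nmD_lt.
  by apply: nmB_lt.
- move=> hd; have x2alpha := x2_norm hd.
  have sub : Uball nm alpha x2 `<=` S alpha by apply: ball_x2_sphere.
  have fx2 : fixed_point f x2 by apply: ratmap_fixed_x2 alpha0 ha nmb nmd.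
  split; first by rewrite /S /Sphere /= subr0.
  + move=> hb; split=> //; last exact: basin_x2.
    split=> //; exists l => //; rewrite nml ltr_pdivrMr ?exprn_gt0 // mul1r.
    exact: slope_x2_lt.
  + move=> hb; have hs := slope_x2_eq nm nm_ge0 nmM nm_ultra a b d alpha
      alpha0 ha nmb nmd hb.
    split=> //.
      by split=> //; exists l => //; rewrite nml hs divff // expf_neq0 // gt_eqF.
    exact: (SI_x2 nm nm_eq0 nm_ge0 nmM nm_ultra a b d alpha alpha0 ha nmb
      nmd hx1 hx2).
Qed.
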